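(* Let $\omega_1,\Omega,\phi_1,\phi_2,\psi_1,\psi_2$ be functions as in the context, and let $A>1$, $\varepsilon>0$, $X_0\ge0$. Let $\alpha$ be a real number satisfying $$\inf_{x\ge X_0}\ \omega_1(x)\cdot\|x\alpha\|\ge 1,$$ and let $\eta$ be an arbitrary real number. Suppose that $$\log_2\left(\frac{X}{2\psi_2^*\left(\frac{\varepsilon}{\phi_2(X)}\right)}\right)\le (A-1)\log_2 X\qquad\text{for all } X\ge X_0,$$ and $$\sup_{X\ge X_0}S^{[2]}_{A,\varepsilon}(X)\le\frac{1}{2^9},$$ where $S^{[2]}_{A,\varepsilon}(X)$ is defined in the context. Then for any sequence of real numbers $\eta_1,\eta_2,\dots,\eta_x,\dots$ there exists a real number $\beta$ such that $$\inf_{x\ge X_0}\ \max\left(\phi_1(x)\cdot\psi_1(\|x\alpha-\eta\|),\ \phi_2(x)\cdot\psi_2(\|x\beta-\eta_x\|)\right)\ge\varepsilon.$$ Here all infima are over positive integers $x\ge X_0$.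
   Context: $\|\cdot\|$ denotes the distance to the nearest integer; $\mathbb{Z}_+$ is the set of positive integers. All functions are non-negative valued functions of non-negative real variables. $\omega_1(t)$ is strictly increasing. $\Omega(x,y)$ is a function of two variables such that for all $x,y,z\in\mathbb{Z}_+$: if $xy\le\omega_1(z/x)$ and $x\le z$, then $x\le\Omega(y,z)$. The functions $\phi_1,\phi_2,\psi_1,\psi_2$ are increasing with $\phi_1(0)=\phi_2(0)=\psi_1(0)=\psi_2(0)=0$; $\psi_1,\psi_2$ are strictly increasing. For $j=1,2$, $\psi_j^*$ is the inverse function of $\psi_j$, that is, $\psi_j^*(\psi_j(t))=t$ for all non-negative real $t$. For $\varepsilon>0$ and an integer $\nu$ put $$\delta^{[2]}_\varepsilon(\nu)=\psi_2^*\left(\frac{\varepsilon}{\phi_2(2^\nu)}\right),\qquad r_\varepsilon(\nu)=\psi_1^*\left(\frac{\varepsilon}{\phi_1(2^\nu)}\right).$$ For $A>1$ put $$S^{[2]}_{A,\varepsilon}(X)=\sum_{X\le\nu<A(X+1)}\delta^{[2]}_\varepsilon(\nu)\cdot\max\left(\Omega\left(\frac{1}{2r_\varepsilon(\nu)},\,2^{\nu+1}\right),\ 2^\nu r_\varepsilon(\nu),\ 1\right),$$ where $\nu$ runs over integers.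
   Formalization: The literal claim is false; mended: S_{A,ε}(X) ≤ 1/2^9 is required for all X ≥ 0 with 2^{X+1} > X_0, ω_1(x)‖xα‖ ≥ 1 for all positive integers x, and the condition on Ω for all real y > 0. Also ψ_j^* is nonnegative and nondecreasing and φ_j(2^ν) ≠ 0. *)

(* Defs.v *)
From mathcomp Require Import all_boot all_order all_algebra.
From mathcomp Require Import all_classical all_reals all_analysis.

Set Implicit Arguments.
Unset Strict Implicit.
Unset Printing Implicit Defensive.

Import Order.TTheory GRing.Theory Num.Theory.

Local Open Scope classical_set_scope.
Local Open Scope ring_scope.

(* A function of a non-negative real variable is a total map R -> R of which
   only the restriction to [0, +oo[ is ever constrained. *)

Definition nonneg_fun (R : realType) (f : R -> R) : Prop :=
  forall t : R, 0 <= t -> 0 <= f t.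

Definition increasing (R : realType) (f : R -> R) : Prop :=
  forall s t : R, 0 <= s -> s <= t -> f s <= f t.

Definition strictly_increasing (R : realType) (f : R -> R) : Prop :=
  forall s t : R, 0 <= s -> s < t -> f s < f t.

(* The equation alone leaves [psi'] arbitrary off the range of [psi], which may
   be a proper subset of [0, +oo[ when [psi] has jumps; there [psi'] is required
   to be increasing, as the inverse of an increasing function is. *)
Definition inverse_function (R : realType) (psi psi' : R -> R) : Prop :=
  [/\ nonneg_fun psi', increasing psi' &
      forall t : R, 0 <= t -> psi' (psi t) = t].

(* ||x||, the distance from x to the nearest integer. *)
Definition distZ (R : realType) (x : R) : R :=
  Num.min (x - (Num.floor x)%:~R) ((Num.floor x)%:~R + 1 - x).

Definition log2 (R : realType) (x : R) : R := ln x / ln 2.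

(* [y] is real, since below [Omega] is evaluated at the real number
   1 / (2 r(nu)). *)
Definition admissible_Omega (R : realType) (omega1 : R -> R)
    (Omega : R -> R -> R) : Prop :=
  forall (x z : nat) (y : R), (0 < x)%N -> (0 < z)%N -> 0 < y ->
    x%:R * y <= omega1 (z%:R / x%:R) -> (x <= z)%N -> x%:R <= Omega y z%:R.

(* psi^* (eps / phi(2^nu)): the quantity delta for (phi_2, psi_2) and the
   quantity r for (phi_1, psi_1). *)
Definition radius (R : realType) (phi psi' : R -> R) (eps : R) (nu : int) : R :=
  psi' (eps / phi (2 ^ nu)).

Definition S2 (R : realType) (Omega : R -> R -> R)
    (phi1 phi2 psi1' psi2' : R -> R) (A eps X : R) : R :=
  let delta := radius phi2 psi2' eps in
  let r := radius phi1 psi1' eps in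
  \sum_(nu \in [set nu : int | X <= nu%:~R < A * (X + 1)])
     delta nu * Num.max (Omega (1 / (2 * r nu)) (2 ^ (nu + 1)))
                        (Num.max (2 ^ nu * r nu) 1).

(* Main.v *)
(** The argument is that of Peres and Schlag.  For n with X0 < 2^(n+1), let B_n
    be the set of x in [2^n, 2^(n+1)[ with ||x alpha - eta|| <= r(n).  It is
    enough to find beta with ||x beta - eta_x|| > delta(n) for all x in all B_n.

    The points (x, x alpha - eta - p) are points of a planar lattice in a box of
    size 2^n by 2 r(n).  Splitting them into lines parallel to their shortest
    difference gives |B_n| <= 10 max(Omega(1 / (2 r(n)), 2^(n+1)), 2^n r(n), 1):
    the points on one line are controlled by Omega, the number of lines by area.

    Starting from [0, 1], remove for successive n all dyadic intervals of length
    2^-l(n), comparable to delta(n) / 2^n, that come close to a zero of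
    ||x beta - eta_x|| for some x in B_n.  Let m(n) be the measure left before
    stage n, and kap(n) the first k with l(k) > n.  What is left before stage
    kap(n) consists of intervals of length at least 2^-n, in each of which stage
    n removes a proportion of at most 6 delta(n) |B_n|.  Hence
      m(n+1) >= m(n) - 6 delta(n) |B_n| m(kap(n)),
    and m(n+1) >= m(kap(n)) / 2 follows by induction as soon as the coefficients
    between kap(n) and n add up to at most 1/4.  The logarithmic hypothesis puts
    these indices in two of the windows over which S2 is bounded.  As m(n) > 0
    for all n, compactness gives beta. *)

Require Import Defs.
From mathcomp Require Import all_boot all_order all_algebra.
From mathcomp Require Import all_classical all_reals all_analysis.
From mathcomp Require Import ring lra zify.
Import Order.TTheory GRing.Theory Num.Theory numFieldNormedType.Exports.
Local Open Scope classical_set_scope.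
Local Open Scope ring_scope.

(** * Distance to the nearest integer and separated points *)

Lemma distZ_le (R : realType) (x : R) (k : int) : distZ x <= `|x - k%:~R|.
Proof.
have /andP[lx ux] := floor_itv x; rewrite intrD in ux.
rewrite /distZ ge_min; apply/orP.
have [kx|kx] := leP k (Num.floor x).
  left; have : k%:~R <= (Num.floor x)%:~R :> R by rewrite ler_int.
  by move=> ?; rewrite ger0_norm; lra.
right; have : (Num.floor x + 1)%:~R <= k%:~R :> R by rewrite ler_int lezD1.
by rewrite intrD => ?; rewrite ler0_norm; lra.
Qed.

Lemma distZ_eq (R : realType) (x : R) : exists k : int, distZ x = `|x - k%:~R|.
Proof.
have /andP[lx ux] := floor_itv x; rewrite intrD in ux.
rewrite /distZ; case: ltP => _.
  by exists (Num.floor x); rewrite ger0_norm // subr_ge0.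
exists (Num.floor x + 1); rewrite intrD ler0_norm; lra.
Qed.

Lemma distZ_ge0 (R : realType) (x : R) : 0 <= distZ x.
Proof. by have [k ->] := distZ_eq R x. Qed.

Lemma distZ_lipschitz (R : realType) (x y : R) : distZ x <= distZ y + `|x - y|.
Proof.
have [k ->] := distZ_eq R y; apply: le_trans (distZ_le R x k) _.
have -> : x - k%:~R = (y - k%:~R) + (x - y) by ring.
exact: ler_normD.
Qed.

(** Once the values are sorted, consecutive ones differ by at least [d], so [(size s - 1) * d] is at
    most the diameter [l]. The form [l + d] also covers an empty [s]. *)
Lemma size_separated (R : realType) (T : eqType) (g : T -> R) (d l : R)
    (s : seq T) :
  uniq s -> 0 <= d -> 0 <= l ->
  {in s &, forall x y, x != y -> d <= `|g x - g y|} ->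
  {in s &, forall x y, `|g x - g y| <= l} ->
  (size s)%:R * d <= l + d.
Proof.
move=> us d0 l0 sep diam.
move: d0; rewrite le_eqVlt => /orP[/eqP<-|d0]; first by rewrite mulr0 addr0.
set t := sort <=%R (map g s).
have ut : uniq t.
  rewrite sort_uniq map_inj_in_uniq // => x y xs ys gxy.
  by apply: contraTeq d0 => /(sep _ _ xs ys); rewrite gxy subrr normr0 -leNgt.
have mt (z : R) : z \in t -> exists2 x, x \in s & z = g x.
  by rewrite mem_sort => /mapP.
have st : sorted (fun a b => d <= b - a) t.
  have : sorted <%R t by rewrite lt_sorted_uniq_le ut sort_le_sorted.
  apply: (@sub_in_sorted _ [in t]); last exact/allP.
  move=> a b /mt[x xs ->] /mt[y ys ->] /= lxy.
  rewrite -(@gtr0_norm _ (g y - g x)) ?subr_gt0//; apply: sep => //.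
  by apply: contraTneq lxy => ->; rewrite ltxx.
rewrite -(size_map g) -(size_sort <=%R) -/t.
case: t mt st {ut} => [|a t] mt st; first by rewrite mul0r; lra.
have spread : forall (a : R) t, path (fun a b => d <= b - a) a t ->
    (size t)%:R * d <= last a t - a.
  move=> {a t mt st} a t; elim: t a => [|b t IH] a /=.
    by rewrite mul0r subrr.
  by move=> /andP[ab /IH]; rewrite -natr1 mulrDl mul1r; lra.
have [x xs ax] := mt a (mem_head _ _).
have [y ys ty] := mt _ (mem_last a t).
have := spread _ _ st; rewrite ty ax.
have := ler_norm (g y - g x); have := diam _ _ ys xs.
by rewrite /= -natr1 mulrDl; lra.
Qed.

Lemma size_fibers (T U : eqType) (f : T -> U) (t : seq U) (s : seq T) :
  {subset map f s <= t} ->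
  (size s <= \sum_(u <- t) count (fun x => f x == u) s)%N.
Proof.
move=> sub; have -> : size s = count (fun x => f x \in t) s.
  rewrite -(count_predT s); apply: eq_in_count => x xs /=.
  by rewrite sub ?map_f.
elim: t {sub} => [|u t IH].
  by rewrite big_nil leqn0 -leqn0 -(count_pred0 s).
rewrite big_cons; apply: leq_trans (leq_add (leqnn _) IH).
by rewrite -count_predUI (leq_trans _ (leq_addr _ _))//; apply: sub_count => x.
Qed.

(** Distinct integers are 1-separated, so [f] takes at most [l + 1] values on [s], each at most [K]
    times. *)
Lemma size_int_fibers (R : realType) (T : eqType) (f : T -> int) (l K : R)
    (s : seq T) :
  0 <= l -> 0 <= K ->
  {in s &, forall x y, `|(f x)%:~R - (f y)%:~R : R| <= l} ->
  (forall k, (count (fun x => f x == k) s)%:R <= K) ->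
  (size s)%:R <= (l + 1) * K.
Proof.
move=> l0 K0 diam fib; set t := undup (map f s).
have mt k : k \in t -> exists2 x, x \in s & k = f x by rewrite mem_undup => /mapP.
have : (size t)%:R * 1 <= l + 1.
  apply: (@size_separated R _ (fun k : int => k%:~R)) => //.
  - exact: undup_uniq.
  - move=> x y _ _ xy; rewrite -intrB -intr_norm ler1z -gtz0_ge1 normr_gt0.
    by rewrite subr_eq0.
  - by move=> x y /mt[a ? ->] /mt[b ? ->]; exact: diam.
rewrite mulr1 => st; apply: le_trans (ler_wpM2r K0 st).
have /(size_fibers _ _ f): {subset map f s <= t} by move=> k; rewrite mem_undup.
rewrite -(ler_nat R) => /le_trans; apply.
rewrite natr_sum; elim: t {mt st} => [|k t IH]; first by rewrite big_nil mul0r.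
by rewrite big_cons /= -natr1 mulrDl mul1r addrC lerD.
Qed.

(** * Points close to a line *)

(** The points [(x, err x)] are split into lines parallel to [(d, e)], where [d] is the least
    positive difference within [s]. A line carries at most [m + 1] of them, [m] being the number of
    steps [(d, e)] that fit in a box of size [W] by [2 * r]; there are at most
    [2 * d * r + |e| * W + 1] lines. *)
Lemma inhomogeneous_count (R : realType) (alpha eta r W : R) (s : seq nat) :
  uniq s -> (1 < size s)%N ->
  (forall d, (0 < d)%N -> 0 < distZ (d%:R * alpha)) ->
  {in s &, forall x y, `|x%:R - y%:R| <= W} ->
  {in s, forall x, distZ (x%:R * alpha - eta) <= r} ->
  exists m d : nat, [/\ (0 < m)%N, (0 < d)%N, m%:R * d%:R <= W,
    m%:R * distZ (d%:R * alpha) <= 2 * r & (size s)%:R <= 8 * r * W + m%:R + 1].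
Proof.
move=> us s_gt1 irr diam near_eta.
have [p pE] := choice (fun x : nat => distZ_eq R (x%:R * alpha - eta)).
pose err x := x%:R * alpha - eta - (p x)%:~R.
have err_le x : x \in s -> `|err x| <= r by move/near_eta; rewrite pE.
have err_diam : {in s &, forall x y, `|err x - err y| <= 2 * r}.
  move=> x y /err_le rx /err_le ry; rewrite (le_trans (ler_normB _ _))//; lra.
pose P d := (0 < d)%N && has (fun x => (x + d)%N \in s) s.
have PB x y : x \in s -> y \in s -> (x < y)%N -> P (y - x)%N.
  move=> xs ys xy; rewrite /P subn_gt0 xy; apply/hasP; exists x => //.
  by rewrite subnKC // ltnW.
have exP : exists d, P d.
  case: s us s_gt1 @P PB {diam near_eta err_le err_diam} => [|x [|y s]] // us _ P PB.
  have : x != y by move: us; rewrite /= inE negb_or => /andP[/andP[]].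
  rewrite neq_ltn => /orP[] xy; [exists (y - x)%N|exists (x - y)%N].
    by apply: PB; rewrite ?inE ?eqxx ?orbT.
  by apply: PB; rewrite ?inE ?eqxx ?orbT.
have [d /andP[d0 /hasP[x0 x0s x0ds]] d_min] := ex_minnP exP.
have sep : {in s &, forall x y, x != y -> (d%:R : R) <= `|x%:R - y%:R|}.
  move=> x y xs ys; rewrite neq_ltn => /orP[] xy.
    rewrite distrC -natrB ?(ltnW xy)// normr_nat ler_nat; exact/d_min/PB.
  rewrite -natrB ?(ltnW xy)// normr_nat ler_nat; exact/d_min/PB.
pose q := p (x0 + d)%N - p x0.
pose e := err (x0 + d)%N - err x0.
have eE : e = d%:R * alpha - q%:~R by rewrite /e /err /q intrB natrD; ring.
have de : distZ (d%:R * alpha) <= `|e| by rewrite eE distZ_le.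
have e0 : 0 < `|e| by exact: lt_le_trans (irr _ d0) de.
have er : `|e| <= 2 * r by exact: err_diam.
have r0 : 0 < r by lra.
have dW : d%:R <= W.
  by have := diam _ _ x0ds x0s; rewrite natrD addrAC subrr add0r normr_nat.
have d0R : 0 < d%:R :> R by rewrite ltr0n.
(* [f x] is the determinant of the shortest difference [(d, q)] and [(x, p x)]:
   it is constant on the lines parallel to that difference. *)
pose f x : int := d%:Z * p x - q * x%:Z.
have fE x : (f x)%:~R = e * x%:R - d%:R * err x - d%:R * eta :> R.
  by rewrite /f intrB !intrM eE /err !pmulrn; ring.
have f_diam : {in s &, forall x y,
    `|(f x)%:~R - (f y)%:~R : R| <= d%:R * (2 * r) + `|e| * W}.
  move=> x y xs ys; rewrite !fE.
  have -> : e * x%:R - d%:R * err x - d%:R * eta - (e * y%:R - d%:R * err y -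
    d%:R * eta) = d%:R * (err y - err x) + e * (x%:R - y%:R) :> R by ring.
  rewrite (le_trans (ler_normD _ _))// !normrM lerD//.
    by rewrite gtr0_norm// ler_pM2l// err_diam.
  by rewrite ler_pM2l// diam.
pose z := Num.min (W / d%:R) (2 * r / `|e|).
have z1 : 1 <= z by rewrite le_min !ler_pdivlMr// !mul1r dW.
pose m := Num.truncn z.
have m0 : (0 < m)%N by rewrite truncn_gt0.
have : m%:R <= z by rewrite truncn_le; lra.
rewrite le_min !ler_pdivlMr// => /andP[mdW mer].
have fib k : (count (fun x => f x == k) s)%:R <= m%:R + 1 :> R.
  rewrite -size_filter; set t := seq.filter _ s.
  have ts x : x \in t -> x \in s /\ f x = k.
    by rewrite mem_filter => /andP[/eqP].
  have ut : uniq t by rewrite filter_uniq.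
  have : (size t)%:R * d%:R <= W + d%:R.
    apply: (@size_separated R _ (fun x => x%:R)) => //; first lra.
      by move=> x y /ts[xs _] /ts[ys _]; exact: sep.
    by move=> x y /ts[xs _] /ts[ys _]; exact: diam.
  have : (size t)%:R * `|e| <= 2 * r + `|e|.
    apply: (@size_separated R _ err) => //; first lra.
      (* On one line [e * (x - y) = d * (err x - err y)]; hence [|x - y| >= d] forces
         [|err x - err y| >= |e|]. *)
      move=> x y /ts[xs fx] /ts[ys fy] xy.
      have exy : e * (x%:R - y%:R) = d%:R * (err x - err y).
        by have := fE x; have := fE y; rewrite fx fy => -> fxy; lra.
      rewrite -(ler_pM2l d0R) -[X in X * `|err x - err y|]gtr0_norm// -normrM -exy.
      by rewrite normrM mulrC ler_pM2l// sep.
    by move=> x y /ts[xs _] /ts[ys _]; exact: err_diam.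
  case: (size t) => [|n]; first by rewrite addr_ge0.
  rewrite -natr1 !mulrDl !mul1r !lerD2r => ne nd.
  by rewrite ler_nat truncn_ge_nat ?le_min ?ler_pdivlMr ?nd//; lra.
exists m, d; split => //.
  by rewrite (le_trans _ mer)// ler_pM2l// ltr0n.
have := @size_int_fibers R _ f (d%:R * (2 * r) + `|e| * W) (m%:R + 1) s.
have m1 : 1 <= m%:R :> R by rewrite ler1n.
have W0 : 0 < W by lra.
have l0 : 0 <= d%:R * (2 * r) + `|e| * W by rewrite addr_ge0// mulr_ge0//; lra.
move=> /(_ l0 (addr_ge0 (ler0n _ _) ler01) f_diam fib) /le_trans; apply.
(* As [m + 1 <= 2 * m], the product of the two bounds exceeds [m + 1] by at most [2 * m * (2 * d * r
   + |e| * W) <= 8 * r * W]. *)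
have h1 : (m%:R * d%:R) * r <= W * r by rewrite ler_pM2r.
have h2 : (m%:R * `|e|) * W <= 2 * r * W by rewrite ler_pM2r.
nra.
Qed.

(** The integers nearest to [j * theta - eta] span at most [n * theta + 2 * rho]; the [j] sharing
    one of them have [j * theta] in an interval of length [2 * rho], with gaps at least [theta]. *)
Lemma progression_count (R : realType) (theta eta rho : R) (a n : nat) :
  0 < theta -> 0 <= rho ->
  (count (fun j => distZ (j%:R * theta - eta) <= rho) (iota a n))%:R <=
    (n%:R * theta + 2 * rho + 1) * (2 * rho / theta + 1).
Proof.
move=> th0 rho0; rewrite -size_filter; set s := seq.filter _ _.
have us : uniq s by rewrite filter_uniq ?iota_uniq.
have [p pE] := choice (fun j : nat => distZ_eq R (j%:R * theta - eta)).
have ps j : j \in s -> `|j%:R * theta - eta - (p j)%:~R| <= rho.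
  by rewrite mem_filter pE => /andP[].
have js j : j \in s -> (a <= j < a + n)%N.
  by rewrite mem_filter mem_iota => /andP[].
have l0 : 0 <= n%:R * theta + 2 * rho by rewrite addr_ge0// mulr_ge0// ltW.
have K0 : 0 <= 2 * rho / theta + 1.
  by rewrite addr_ge0// divr_ge0 ?mulr_ge0// ltW.
apply: (@size_int_fibers R _ p _ _ s l0 K0).
  move=> x y xs ys; have := ps _ xs; have := ps _ ys.
  rewrite !ler_norml => /andP[y1 y2] /andP[x1 x2].
  have xy : `|x%:R - y%:R| <= n%:R :> R.
    have /andP[ax xn] := js _ xs; have /andP[ay yn] := js _ ys.
    have : a%:R <= x%:R :> R by rewrite ler_nat.
    have : a%:R <= y%:R :> R by rewrite ler_nat.
    have : x%:R <= a%:R + n%:R :> R by rewrite -natrD ler_nat ltnW.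
    have : y%:R <= a%:R + n%:R :> R by rewrite -natrD ler_nat ltnW.
    rewrite ler_norml; lra.
  have : `|x%:R * theta - y%:R * theta| <= n%:R * theta.
    by rewrite -mulrBl normrM (gtr0_norm th0) ler_pM2r.
  rewrite ler_norml => /andP[? ?]; apply/andP; split; lra.
move=> k; rewrite -size_filter; set t := seq.filter _ s.
have ts x : x \in t -> x \in s /\ p x = k by rewrite mem_filter => /andP[/eqP].
rewrite -(ler_pM2r th0) mulrDl mulfVK ?gt_eqF// mul1r.
apply: (@size_separated R _ (fun j => j%:R * theta)) => //.
- by rewrite filter_uniq.
- exact: ltW.
- by rewrite mulr_ge0.
- move=> x y _ _ xy; rewrite -mulrBl normrM (gtr0_norm th0) (ler_peMl (ltW th0))//.
  have [yx|yx] := leqP y x.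
    by rewrite -natrB// normr_nat ler1n subn_gt0 ltn_neqAle yx andbT eq_sym.
  by rewrite distrC -natrB 1?ltnW// normr_nat ler1n subn_gt0.
- move=> x y /ts[/ps + px] /ts[/ps + py]; rewrite px py.
  by rewrite !ler_norml => /andP[? ?] /andP[? ?]; apply/andP; split; lra.
Qed.

(** * The sieve *)

(** Strong induction on [n]. For [kap n <= i <= n], the bound at [(kap n).-1] gives
    [m (kap i) <= 2 * m (kap n)], so the stages from [kap n] to [n] remove at most a quarter of
    [2 * m (kap n)]. *)
Lemma sieve_recursion (R : realType) (m c : nat -> R) (kap : nat -> nat)
    (n0 N : nat) :
  (forall n, 0 <= m n) -> (forall n, 0 <= c n) ->
  (forall n, (n0 <= n < N)%N -> (n0 <= kap n <= n)%N) ->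
  (forall n n', (n0 <= n <= n')%N -> (n' < N)%N -> (kap n <= kap n')%N) ->
  (forall n n', (n <= n')%N -> m n' <= m n) ->
  (forall n, (n0 <= n < N)%N -> m n - c n * m (kap n) <= m n.+1) ->
  (forall n, (n0 <= n < N)%N -> \sum_(kap n <= k < n.+1) c k <= 1 / 4) ->
  forall n, (n0 <= n < N)%N -> m (kap n) <= 2 * m n.+1.
Proof.
move=> m0 c0 kapP kap_mono m_decr step csum.
have telescope M k t : (n0 <= k)%N -> (k + t <= N)%N ->
    (forall i, (k <= i < k + t)%N -> m (kap i) <= M) ->
    m k - (\sum_(k <= i < k + t) c i) * M <= m (k + t)%N.
  move=> n0k; elim: t => [|t IH] ktN mM.
    by rewrite addn0 big_geq// mul0r subr0.
  rewrite addnS in ktN mM *; rewrite big_nat_recr ?leq_addr//= mulrDl.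
  have kt : (k <= k + t)%N by rewrite leq_addr.
  have := step (k + t)%N; rewrite ktN (leq_trans n0k kt) => /(_ isT).
  have := IH (ltnW ktN) _.
  have : c (k + t)%N * m (kap (k + t)%N) <= c (k + t)%N * M.
    by rewrite ler_wpM2l// mM// kt ltnSn.
  move=> h1 h2 h3; suff : m k - (\sum_(k <= i < k + t) c i) * M <= m (k + t)%N.
    by lra.
  by apply: h2 => i /andP[ki it]; apply: mM; rewrite ki ltnW.
elim/ltn_ind => n IH nN; have /andP[n0k kn] := kapP n nN.
have /andP[n0n nltN] := nN.
have mM i : (kap n <= i < n.+1)%N -> m (kap i) <= 2 * m (kap n).
  move=> /andP[ki]; rewrite ltnS => i_n.
  (* If [kap n = n0], there is no earlier stage to use, but monotonicity forces [kap i = n0] as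
     well. *)
  have [kn0|kn0] := eqVneq (kap n) n0.
    have : (kap i <= kap n)%N by rewrite kap_mono ?(leq_trans n0k ki).
    rewrite {1}kn0 => kin0.
    have /andP[n0i _] : (n0 <= kap i <= i)%N.
      by rewrite kapP// (leq_trans n0k ki) (leq_ltn_trans i_n).
    have -> : kap i = kap n by rewrite kn0; apply/eqP; rewrite eqn_leq kin0.
    by have := m0 (kap n); lra.
  have n0k' : (n0 < kap n)%N by rewrite ltn_neqAle eq_sym kn0.
  have kn1 : (kap n).-1.+1 = kap n by rewrite prednK// (leq_ltn_trans _ n0k').
  have n0k1 : (n0 <= (kap n).-1)%N by rewrite -ltnS kn1.
  have k1i : ((kap n).-1 <= i)%N by rewrite (leq_trans _ ki)// -[leqRHS]kn1.
  have k1n : ((kap n).-1 < n)%N by rewrite kn1.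
  have := IH _ k1n; rewrite n0k1 (ltn_trans k1n nltN) kn1 => /(_ isT).
  apply: le_trans; apply: m_decr; apply: kap_mono; first by rewrite n0k1.
  exact: leq_ltn_trans nltN.
have nE : (n.+1 = kap n + (n.+1 - kap n))%N by rewrite subnKC// leqW.
have := telescope (2 * m (kap n)) (kap n) (n.+1 - kap n)%N n0k.
rewrite -nE => /(_ nltN mM) h.
have : (\sum_(kap n <= i < n.+1) c i) * (2 * m (kap n)) <=
    1 / 4 * (2 * m (kap n)) by rewrite ler_wpM2r ?mulr_ge0// csum.
by lra.
Qed.

(** [P (j %/ n)] is constant on each block of [n] consecutive integers: a block where it fails
    contributes to neither side, and on the others the density bound for [Q] applies. *)
Lemma count_chunks (R : realType) (P Q : pred nat) (D : R) (n c : nat) :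
  (0 < n)%N -> (forall a, (count Q (iota (a * n) n))%:R <= D * n%:R) ->
  (count (fun j => P (j %/ n)%N && Q j) (iota 0 (c * n)))%:R <=
    D * (count (fun j => P (j %/ n)%N) (iota 0 (c * n)))%:R.
Proof.
move=> n0 QD; elim: c => [|c IH]; first by rewrite mul0n mulr0.
rewrite mulSn addnC iotaD add0n !count_cat !natrD mulrDr lerD//.
have jc j : j \in iota (c * n) n -> (j %/ n = c)%N.
  rewrite mem_iota => /andP[cj jn]; rewrite -(subnKC cj) divnMDl// divn_small ?addn0//.
  by rewrite ltn_subLR.
have [Pc|Pc] := boolP (P c).
  rewrite (@eq_in_count _ _ Q) => [|j /jc ->]; last by rewrite Pc.
  rewrite (@eq_in_count _ (fun j => P (j %/ n)%N) predT) => [|j /jc ->]; last first.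
    by rewrite Pc.
  by rewrite count_predT size_iota.
rewrite (@eq_in_count _ _ pred0) => [|j /jc ->]; last by rewrite (negPf Pc).
rewrite (@eq_in_count _ (fun j => P (j %/ n)%N) pred0) => [|j /jc ->]; last first.
  by rewrite (negPf Pc).
by rewrite count_pred0 mulr0.
Qed.

Lemma count_has_le (T U : Type) (p : U -> pred T) (s : seq U) (t : seq T) :
  (count (fun j => has (p^~ j) s) t <= \sum_(x <- s) count (p x) t)%N.
Proof.
elim: s => [|x s IH]; first by rewrite big_nil count_pred0.
rewrite big_cons; apply: leq_trans (leq_add (leqnn _) IH).
rewrite -count_predUI (leq_trans _ (leq_addr _ _))//; exact: sub_count.
Qed.

Lemma ex_dyadic_level (R : realType) (d : R) (n : nat) : 0 < d ->
  exists l, 2 ^+ n <= d * 2 ^+ l /\ forall t, 2 ^+ n <= d * 2 ^+ t -> (l <= t)%N.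
Proof.
move=> d0; have ex : exists l, (2 ^+ n <= d * 2 ^+ l :> R).
  exists (Num.truncn (2 ^+ n / d)).+1; rewrite mulrC -ler_pdivrMr//.
  have q0 : 0 <= 2 ^+ n / d :> R by rewrite divr_ge0 ?exprn_ge0// ltW.
  have /andP[_ /ltW/le_trans] := truncn_itv q0; apply.
  by rewrite -[leRHS]natrX ler_nat ltnW// ltn_expl.
by have [l ? ?] := ex_minnP ex; exists l.
Qed.

Lemma progression_density (R : realType) (d eta : R) (L x a n : nat) :
  0 < d -> d <= 1 / 2 ^+ 9 -> (0 < x)%N ->
  x%:R / 2 ^+ L <= d / 8 :> R -> 1 <= n%:R * (x%:R / 2 ^+ L) :> R ->
  (count (fun j => distZ (x%:R * (j%:R / 2 ^+ L) - eta) <= 11 / 8 * d)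
     (iota a n))%:R <= 6 * d * n%:R.
Proof.
move=> d0 d1 x0; set th : R := x%:R / 2 ^+ L => thd nth.
have th0 : 0 < th by rewrite divr_gt0 ?ltr0n ?exprn_gt0.
have rho0 : 0 <= 11 / 8 * d by lra.
have := progression_count R th eta (11 / 8 * d) a n th0 rho0.
rewrite (@eq_count _ _ (fun j => distZ (x%:R * (j%:R / 2 ^+ L) - eta) <= 11 / 8 * d)).
  move=> /le_trans; apply.
  have d2 : d <= 1 / 512 by move: d1; rewrite !exprS expr0; lra.
  have -> : 6 * d * n%:R = (6 * d * (n%:R * th)) / th.
    by field; rewrite gt_eqF.
  have -> : 2 * (11 / 8 * d) / th + 1 = (22 / 8 * d + th) / th.
    by field; rewrite gt_eqF.
  rewrite [leLHS]mulrA ler_pM2r ?invr_gt0//.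
  move: (n%:R * th) nth => z z1.
  (* The factors are bounded by [22 / 8 * d + 1 <= 101 / 100 * z] and [th <= d / 8]; the product
     [201 / 100 * 23 / 8] is below 6. *)
  apply: (@le_trans _ _ ((201 / 100 * z) * (23 / 8 * d))); last by nra.
  by apply: ler_pM; lra.
by move=> j /=; rewrite [in RHS]mulrCA.
Qed.

Lemma dyadic_ancestor (R : realType) (j l L : nat) : (l <= L)%N ->
  (j %/ 2 ^ (L - l))%N%:R / 2 ^+ l <= j%:R / 2 ^+ L :> R /\
  (j%:R + 1) / 2 ^+ L <= ((j %/ 2 ^ (L - l))%N%:R + 1) / 2 ^+ l :> R.
Proof.
move=> lL; set h := (2 ^ (L - l))%N; set b := (j %/ h)%N.
have LE : 2 ^+ L = h%:R * 2 ^+ l :> R by rewrite natrX -exprD subnK.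
have h0 : 0 < h%:R :> R by rewrite ltr0n expn_gt0.
have l0 : 0 < 2 ^+ l :> R by rewrite exprn_gt0.
have bj : b%:R * h%:R <= j%:R :> R by rewrite -natrM ler_nat leq_divM.
have jb : j%:R + 1 <= (b%:R + 1) * h%:R :> R.
  by rewrite !natr1 -natrM ler_nat ltn_ceil// expn_gt0.
rewrite LE invfM !mulrA !(ler_pM2r (_ : 0 < (2 ^+ l)^-1)) ?invr_gt0//.
by rewrite ler_pdivlMr// ler_pdivrMr.
Qed.

Lemma dyadic_sieve (R : realType) (delta : nat -> R) (B : nat -> seq nat)
    (etas : nat -> R) (n0 N : nat) :
  (n0 <= N)%N ->
  (forall n, 0 <= delta n) ->
  (forall n, (n0 <= n < N)%N -> 0 < delta n <= 1 / 2 ^+ 9) ->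
  (forall n n', (n0 <= n)%N -> (n <= n')%N -> delta n' <= delta n) ->
  (forall n x, x \in B n -> (2 ^ n <= x < 2 ^ n.+1)%N) ->
  (forall n n', (n0 <= n)%N -> (n <= n')%N -> (n' < N)%N ->
    delta n * 2 ^+ n' < 2 ^+ (n + 4) ->
    \sum_(n <= k < n'.+1) delta k * (size (B k))%:R <= 10 / 2 ^+ 8) ->
  exists a h : R, [/\ 0 <= a, 0 < h, a + h <= 1 &
    forall beta, a <= beta <= a + h ->
    forall n x, (n0 <= n < N)%N -> x \in B n ->
    9 / 8 * delta n <= distZ (x%:R * beta - etas x)].
Proof.
move=> n0N delta_ge0 deltaP delta_decr BP window.
(* Since [x < 2 ^ (n + 1)] on [B n], this level makes [x * beta] vary by at most [delta n / 8] on an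
   interval of length [2 ^ - l n]. Outside [[n0, N[] the value of [l] is arbitrary. *)
have /choice[l lP] n : exists l, (n0 <= n < N)%N ->
    2 ^+ (n + 4) <= delta n * 2 ^+ l /\
    forall t, 2 ^+ (n + 4) <= delta n * 2 ^+ t -> (l <= t)%N.
  have [nN|_] := boolP (n0 <= n < N)%N; last by exists 0%N.
  have /andP[d0 _] := deltaP _ nN.
  by have [l ?] := ex_dyadic_level R (delta n) (n + 4) d0; exists l.
have l_mono n n' : (n0 <= n)%N -> (n <= n')%N -> (n' < N)%N -> (l n <= l n')%N.
  move=> n0n nn' n'N; have nN : (n0 <= n < N)%N by rewrite n0n (leq_ltn_trans nn').
  apply: (proj2 (lP _ nN)).
  have [|le_l _] := lP n'; first by rewrite (leq_trans n0n nn').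
  apply: le_trans (le_trans le_l _).
    by rewrite ler_eXn2l ?ltr1n// leq_add2r.
  by rewrite ler_pM2r ?exprn_gt0// delta_decr.
have l_gt n : (n0 <= n < N)%N -> (n < l n)%N.
  move=> nN; have [le_l _] := lP _ nN; have /andP[d0 d1] := deltaP _ nN.
  rewrite -(@ltr_eXn2l R 2) ?ltr1n//; apply: lt_le_trans (le_trans le_l _).
    by rewrite ltr_eXn2l ?ltr1n// -addSnnS leq_addr.
  rewrite ler_piMl ?exprn_ge0// (le_trans d1)// div1r invf_le1 ?exprn_gt0//.
  by rewrite exprn_ege1// ler1n.
(* The finest level: the intervals of all stages are unions of intervals of length [2 ^ - L], so
   measures become counts. *)
pose L := l N.-1.
have lL n : (n0 <= n < N)%N -> (l n <= L)%N.
  case/andP => n0n nN; have N0 : (0 < N)%N by rewrite (leq_ltn_trans _ nN).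
  by apply: l_mono; rewrite // ?prednK// -ltnS prednK.
have width n x : (n0 <= n < N)%N -> x \in B n -> x%:R / 2 ^+ l n <= delta n / 8 :> R.
  move=> nN /BP /andP[_ xn]; have [le_l _] := lP _ nN.
  rewrite ler_pdivrMr ?exprn_gt0// mulrAC ler_pdivlMr//.
  apply: le_trans le_l; rewrite addnC exprD.
  have : x%:R <= 2 ^+ n.+1 :> R by rewrite -natrX ler_nat ltnW.
  by rewrite exprS !exprS expr0; lra.
have approx n x (b : nat) (beta : R) : (n0 <= n < N)%N -> x \in B n ->
    b%:R / 2 ^+ l n <= beta <= (b%:R + 1) / 2 ^+ l n ->
    `|x%:R * (b%:R / 2 ^+ l n) - x%:R * beta| <= delta n / 8.
  move=> nN xB /andP[b1 b2]; apply: le_trans (width _ _ nN xB).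
  rewrite -mulrBr normrM normr_nat ler_wpM2l// distrC ger0_norm ?subr_ge0//.
  by move: b2; rewrite mulrDl mul1r; lra.
(* Only the left endpoint is tested. With an error of at most [delta n / 8], the threshold [5 / 4]
   ensures [9 / 8] on a kept interval and allows at most [11 / 8] on a removed one. *)
pose bad n (b : nat) :=
  has (fun x => distZ (x%:R * (b%:R / 2 ^+ l n) - etas x) <= 5 / 4 * delta n) (B n).
(* The integer [j < 2 ^ L] stands for [j / 2 ^ L, (j + 1) / 2 ^ L]; [anc n j]
   is the index of the dyadic interval of length 2 ^ - l n containing it. *)
pose anc n j := (j %/ 2 ^ (L - l n))%N.
pose E k j := all (fun n => ~~ bad n (anc n j)) (index_iota n0 k).
pose m k : R := (count (E k) (iota 0 (2 ^ L)))%:R.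
have bad_near n j : (n0 <= n < N)%N -> bad n (anc n j) ->
    has (fun x => distZ (x%:R * (j%:R / 2 ^+ L) - etas x) <= 11 / 8 * delta n) (B n).
  move=> nN /hasP[x xB near]; apply/hasP; exists x => //.
  have [a1 a2] := dyadic_ancestor R j _ _ (lL _ nN).
  have := approx n x (anc n j) (j%:R / 2 ^+ L) nN xB.
  rewrite a1 (le_trans _ a2) ?ler_pM2r ?invr_gt0 ?exprn_gt0 ?lerDl// => /(_ isT) ax.
  have := distZ_lipschitz R (x%:R * (j%:R / 2 ^+ L) - etas x)
    (x%:R * ((anc n j)%:R / 2 ^+ l n) - etas x).
  by rewrite opprB addrA subrK distrC; lra.
(* The [s] indices cover a length of at least [2 ^ - n]; as [x >= 2 ^ n] on [B n], [x * beta] runs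
   over at least one full period there. *)
have density n a s : (n0 <= n < N)%N -> (2 ^ L <= 2 ^ n * s)%N ->
    (count (fun j => bad n (anc n j)) (iota a s))%:R <=
      6 * (delta n * (size (B n))%:R) * s%:R.
  move=> nN Ls; have /andP[d0 d1] := deltaP _ nN.
  apply: (@le_trans _ _ (\sum_(x <- B n) 6 * delta n * s%:R)).
    pose near x j := distZ (x%:R * (j%:R / 2 ^+ L) - etas x) <= 11 / 8 * delta n.
    have : (count (fun j => bad n (anc n j)) (iota a s) <=
        \sum_(x <- B n) count (near x) (iota a s))%N.
      apply: leq_trans (count_has_le _ _ near (B n) _).
      by apply: sub_count => j; exact: bad_near.
    rewrite -(ler_nat R) => /le_trans; apply.
    rewrite natr_sum big_seq [leRHS]big_seq; apply: ler_sum => x xB.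
    have /andP[nx _] := BP _ _ xB.
    apply: progression_density => //.
    - by rewrite (leq_trans _ nx)// expn_gt0.
    - apply: le_trans (width _ _ nN xB).
      by rewrite ler_wpM2l// lef_pV2 ?posrE ?exprn_gt0// ler_eXn2l ?ltr1n// lL.
    - rewrite mulrA ler_pdivlMr ?exprn_gt0// mul1r -natrX -natrM ler_nat.
      by rewrite (leq_trans Ls)// mulnC leq_mul2l nx orbT.
  rewrite big_const_seq count_predT iter_addr addr0 -mulr_natr.
  by rewrite le_eqVlt; apply/orP; left; apply/eqP; ring.
have E_sub k k' j : (k <= k')%N -> E k' j -> E k j.
  move=> kk' /allP Ek'; apply/allP => n; rewrite mem_index_iota => /andP[n0n nk].
  by apply: Ek'; rewrite mem_index_iota n0n (leq_trans nk).
have ES n j : (n0 <= n)%N -> E n.+1 j = E n j && ~~ bad n (anc n j).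
  move=> n0n; rewrite /E /index_iota subSn// -addn1 iotaD all_cat /= subnKC//.
  by rewrite andbT.
have /choice[kap kapP] n : exists k, (n0 <= n < N)%N ->
    [/\ (n0 <= k <= n)%N, (n < l k)%N &
        forall k', (n0 <= k')%N -> (n < l k')%N -> (k <= k')%N].
  have [nN|_] := boolP (n0 <= n < N)%N; last by exists 0%N.
  have ex : exists k, (n0 <= k)%N && (n < l k)%N.
    by exists n; rewrite l_gt// andbT; case/andP: nN.
  have [k /andP[n0k nk] k_min] := ex_minnP ex.
  exists k => _; split => // [|k' ? ?]; last by apply: k_min; apply/andP.
  by rewrite n0k k_min// l_gt// andbT; case/andP: nN.
have m_ge0 k : 0 <= m k by rewrite ler0n.
(* The stages before [kap n] only involve levels up to [l (kap n).-1], which is at most [n] by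
   minimality of [kap n]. So [E (kap n)] is constant on blocks of length at least [2 ^ - n]; if
   [kap n = n0], nothing is removed yet and one block is the whole unit interval. *)
have chunks n : (n0 <= n < N)%N -> exists s c, [/\ (0 < s)%N, (c * s = 2 ^ L)%N,
    (2 ^ L <= 2 ^ n * s)%N & forall j, E (kap n) (j %/ s * s)%N = E (kap n) j].
  move=> nN; have [/andP[n0k kn] nlk k_min] := kapP _ nN.
  have [kn0|kn0] := eqVneq (kap n) n0.
    exists (2 ^ L)%N, 1%N; rewrite mul1n expn_gt0 leq_pmull ?expn_gt0//.
    by split => // j; rewrite /E kn0 /index_iota subnn.
  have n0k' : (n0 < kap n)%N by rewrite ltn_neqAle eq_sym kn0.
  have kE : (kap n).-1.+1 = kap n by rewrite prednK// (leq_ltn_trans _ n0k').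
  have n0k1 : (n0 <= (kap n).-1)%N by rewrite -ltnS kE.
  have kN : ((kap n).-1 < N)%N by rewrite kE (leq_trans kn)// ltnW; case/andP: nN.
  have lkL : (l (kap n).-1 <= L)%N by rewrite lL// n0k1.
  have lkn : (l (kap n).-1 <= n)%N.
    rewrite leqNgt; apply/negP => /(k_min _ n0k1).
    by rewrite -ltnS kE ltnn.
  exists (2 ^ (L - l (kap n).-1))%N, (2 ^ l (kap n).-1)%N.
  rewrite expn_gt0 -!expnD subnKC//; split => //.
    by rewrite leq_exp2l// addnBA// -addnBAC// leq_addl.
  move=> j; apply: eq_in_all => i; rewrite mem_index_iota => /andP[n0i ik].
  have lik : (l i <= l (kap n).-1)%N by rewrite l_mono// -ltnS kE.
  rewrite /anc; have -> : (L - l i = L - l (kap n).-1 + (l (kap n).-1 - l i))%N by lia.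
  by rewrite expnD !divnMA mulnK// expn_gt0.
have step n : (n0 <= n < N)%N ->
    m n - 6 * (delta n * (size (B n))%:R) * m (kap n) <= m n.+1.
  move=> nN; have [s [c [s0 csL Ls Es]]] := chunks _ nN.
  have [/andP[n0k kn] _ _] := kapP _ nN; have /andP[n0n _] := nN.
  have := count_chunks R (fun a => E (kap n) (a * s)%N)
    (fun j => bad n (anc n j)) _ s c s0 (fun a => density n (a * s)%N s nN Ls).
  rewrite csL (@eq_count _ (fun j => E (kap n) (j %/ s * s)%N) (E (kap n))) //.
  rewrite -/(m (kap n)) => removed.
  (* What stage [n] removes from [E n] is contained in what it would remove from the larger set
     [E (kap n)], where the block density applies. *)
  suff : (count (E n) (iota 0 (2 ^ L)) <= count (E n.+1) (iota 0 (2 ^ L)) +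
      count (fun j => E (kap n) (j %/ s * s)%N && bad n (anc n j)) (iota 0 (2 ^ L)))%N.
    by rewrite -(ler_nat R) natrD -/(m n) -/(m n.+1); lra.
  rewrite -count_predUI (leq_trans _ (leq_addr _ _))//; apply: sub_count => j Enj /=.
  by rewrite ES// Enj Es (E_sub _ _ _ kn Enj) orNb.
have halving := sieve_recursion R m (fun n => 6 * (delta n * (size (B n))%:R)) kap n0 N.
have {}halving n : (n0 <= n < N)%N -> m (kap n) <= 2 * m n.+1.
  apply: halving => //.
  - by move=> i; rewrite mulr_ge0// mulr_ge0.
  - by move=> i /kapP[].
  - move=> i i' /andP[n0i ii'] i'N.
    have iN : (n0 <= i < N)%N by rewrite n0i (leq_ltn_trans ii').
    have i'N' : (n0 <= i' < N)%N by rewrite (leq_trans n0i ii').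
    have [_ _ k_min] := kapP _ iN; have [/andP[? _] lk _] := kapP _ i'N'.
    by apply: k_min => //; apply: leq_ltn_trans lk.
  - by move=> i i' ii'; rewrite ler_nat; apply: sub_count => j; exact: E_sub.
  - move=> i iN; have [/andP[n0k ki] ilk _] := kapP _ iN; have /andP[_ ltiN] := iN.
    rewrite -mulr_sumr.
    (* By minimality of the level [l (kap i)], which exceeds [i]. The bound of [window] then
       suffices because [6 * 10 / 2 ^ 8 <= 1 / 4]. *)
    have : delta (kap i) * 2 ^+ i < 2 ^+ (kap i + 4).
      rewrite ltNge; apply/negP; have kN : (n0 <= kap i < N)%N.
        by rewrite n0k (leq_ltn_trans ki).
      by move/(proj2 (lP _ kN)); rewrite leqNgt ilk.
    by move=> /(window _ _ n0k ki ltiN); rewrite !exprS expr0; lra.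
have m_gt0 n : (n0 <= n <= N)%N -> 0 < m n.
  elim/ltn_ind: n => n IH /andP[n0n nN]; move: n0n; rewrite leq_eqVlt.
  case/orP => [/eqP <-|n0n].
    rewrite /m (@eq_count _ _ predT) ?count_predT ?size_iota ?ltr0n ?expn_gt0//.
    by move=> j; rewrite /E /index_iota subnn.
  case: n n0n nN IH => // n n0n nN IH.
  have nN' : (n0 <= n < N)%N by rewrite nN andbT -ltnS.
  have [/andP[n0k kn] _ _] := kapP _ nN'.
  have := halving _ nN'; have := IH (kap n); rewrite ltnS => /(_ kn).
  rewrite n0k (leq_trans kn (ltnW nN)) => /(_ isT); lra.
have : has (E N) (iota 0 (2 ^ L)) by rewrite has_count -(ltr0n R) m_gt0// n0N leqnn.
move=> /hasP[j]; rewrite mem_iota add0n => /andP[_ jL] /allP ENj.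
have L0 : 0 < 2 ^+ L :> R by rewrite exprn_gt0.
exists (j%:R / 2 ^+ L), (1 / 2 ^+ L); split.
- by rewrite divr_ge0// ltW.
- by rewrite divr_gt0.
- by rewrite -mulrDl ler_pdivrMr// mul1r natr1 -natrX ler_nat.
rewrite -mulrDl => beta /andP[jb bj] n x nN xB.
have := ENj n; rewrite mem_index_iota nN => /(_ isT) /hasPn /(_ _ xB).
rewrite -ltNge; have [a1 a2] := dyadic_ancestor R j _ _ (lL _ nN).
have := approx n x (anc n j) beta nN xB; rewrite (le_trans a1 jb) (le_trans bj a2).
move=> /(_ isT) ax far.
have := distZ_lipschitz R (x%:R * ((anc n j)%:R / 2 ^+ l n) - etas x)
  (x%:R * beta - etas x).
rewrite opprB addrA subrK; lra.
Qed.

(** * The hypotheses on alpha and S2 *)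

(** Unless there is at most one point, [inhomogeneous_count] with [W = 2 ^ n] bounds the size by
    [8 * r * 2 ^ n + m + 1]. Moreover [m / (2 * r) <= 1 / ||d alpha|| <= omega1 d], and
    [d <= 2 ^ n / m < 2 ^ (n + 1) / m], so admissibility gives
    [m <= Omega (1 / (2 * r)) (2 ^ (n + 1))]. *)
Lemma near_alpha_count (R : realType) (omega1 : R -> R) (Omega : R -> R -> R)
    (alpha eta r : R) (n : nat) :
  strictly_increasing omega1 ->
  (forall s t : R, 0 <= s -> 0 <= t -> 0 <= Omega s t) ->
  admissible_Omega omega1 Omega ->
  (forall d : nat, (0 < d)%N -> 1 <= omega1 d%:R * distZ (d%:R * alpha)) ->
  0 <= r ->
  (size [seq x <- iota (2 ^ n) (2 ^ n) | distZ (x%:R * alpha - eta) <= r])%:R <=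
    10 * Num.max (Omega (1 / (2 * r)) (2 ^+ n.+1)) (Num.max (2 ^+ n * r) 1).
Proof.
move=> omega_incr Omega_ge0 OmegaP alphaP r0; set s := [seq _ <- _ | _].
set M := Num.max _ _.
have [leOM rM M1] : [/\ Omega (1 / (2 * r)) (2 ^+ n.+1) <= M, 2 ^+ n * r <= M
    & 1 <= M] by rewrite !le_max !lexx !orbT.
have irr d : (0 < d)%N -> 0 < distZ (d%:R * alpha).
  move=> /alphaP; have := distZ_ge0 R (d%:R * alpha).
  by rewrite le_eqVlt => /orP[/eqP <-|//]; rewrite mulr0 ler10.
have [s1|s1] := leqP (size s) 1.
  have : (size s)%:R <= 1 :> R by rewrite lern1.
  by lra.
have diam : {in s &, forall x y, `|x%:R - y%:R| <= 2 ^+ n :> R}.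
  move=> x y; rewrite !mem_filter !mem_iota => /andP[_ /andP[x1 x2]].
  move=> /andP[_ /andP[y1 y2]]; rewrite -natrX.
  move: x1 x2 y1 y2; rewrite -!(ler_nat R) natrD -!natr1.
  by move=> *; rewrite ler_norml; lra.
have near : {in s, forall x, distZ (x%:R * alpha - eta) <= r}.
  by move=> x; rewrite mem_filter => /andP[].
have us : uniq s by rewrite filter_uniq ?iota_uniq.
have [m [d [m0 d0 mdW mdr sm]]] :=
  inhomogeneous_count R alpha eta r (2 ^+ n) s us s1 irr diam near.
have m0R : 0 < m%:R :> R by rewrite ltr0n.
have dist0 := irr _ d0.
have r_gt0 : 0 < r by have := mulr_gt0 m0R dist0; lra.
suff mOm : m%:R <= Omega (1 / (2 * r)) (2 ^+ n.+1) by lra.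
rewrite -natrX; apply: OmegaP => //; first by rewrite expn_gt0.
- by rewrite divr_gt0// mulr_gt0.
- have h : omega1 d%:R < omega1 ((2 ^ n.+1)%N%:R / m%:R).
    apply: omega_incr => //; rewrite ltr_pdivlMr// mulrC natrX.
    by apply: le_lt_trans mdW _; rewrite ltr_eXn2l ?ltr1n.
  apply: le_trans (ltW h); rewrite mulrA mulr1 ler_pdivrMr ?mulr_gt0//.
  rewrite -(ler_pM2r dist0); apply: le_trans mdr _.
  by rewrite mulrAC ler_peMl ?alphaP// mulr_ge0.
- have : (m * d <= 2 ^ n)%N by rewrite -(ler_nat R) natrM natrX.
  by move/(leq_trans (leq_pmulr m d0))/leq_trans; apply; rewrite leq_exp2l.
Qed.

Lemma S2_ge (R : realType) (Omega : R -> R -> R) (phi1 phi2 psi1' psi2' : R -> R)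
    (A eps : R) (n k : nat) :
  let term (i : nat) := Defs.radius phi2 psi2' eps i *
    Num.max (Omega (1 / (2 * Defs.radius phi1 psi1' eps i)) (2 ^+ i.+1))
            (Num.max (2 ^+ i * Defs.radius phi1 psi1' eps i) 1) in
  (forall i : nat, 0 <= Defs.radius phi2 psi2' eps i) ->
  (n <= k)%N -> k%:R < A * (n%:R + 1) ->
  \sum_(n <= i < k.+1) term i <= S2 Omega phi1 phi2 psi1' psi2' A eps n%:R.
Proof.
move=> term rad0 nk kA.
have succE (i : nat) : Posz i + 1 = Posz i.+1 by rewrite -addn1 PoszD.
have term0 i : 0 <= term i by rewrite mulr_ge0// !le_max ler01 !orbT.
set y := A * (n%:R + 1) in kA.
have y0 : 0 <= y by apply: le_trans (ltW kA).
pose r := [seq Posz i | i <- index_iota n (Num.truncn y).+1 & i%:R < y].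
rewrite /S2 (fsbigE r) /=.
- rewrite {}/r big_map big_filter_cond.
  have kT : (k <= Num.truncn y)%N by rewrite truncn_ge_nat// ltW.
  rewrite [leRHS]big_mkcond (@big_cat_nat _ _ _ k.+1)//= ?leqW//.
  rewrite -[leLHS]addr0 lerD//.
    rewrite le_eqVlt; apply/orP; left; apply/eqP/eq_big_nat => i /andP[ni ik].
    have iy : i%:R < y by rewrite (le_lt_trans _ kA)// ler_nat -ltnS.
    rewrite iy mem_set/=; last by rewrite iy ler_nat ni.
    by rewrite succE.
  by apply: sumr_ge0 => i _; case: ifP => // _; rewrite succE; exact: term0.
- by rewrite map_inj_uniq ?filter_uniq ?iota_uniq// => i j [].
- move=> _ /mapP[i + ->]; rewrite mem_filter mem_index_iota => /andP[iy /andP[ni _]].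
  by rewrite /= iy andbT ler_nat.
- move=> i [/andP[ni iy]] /mapP ir; exfalso; apply: ir.
  have i0 : 0 <= i by rewrite -(ler_int R) (le_trans _ ni).
  exists `|i|%N; last by rewrite gez0_abs.
  move: ni iy; rewrite -{1 2}(gez0_abs i0) -!pmulrn => ni iy.
  rewrite mem_filter iy mem_index_iota ltnS truncn_ge_nat// (ltW iy) andbT.
  by rewrite -(ler_nat R).
Qed.

(** Put [D = - log2 d]. The hypotheses become [n + D <= (A - 1) * (n + 1)] and [n' < n + 4 + D],
    whence [n' < A * (n + 1) + 3 - n]. *)
Lemma window_length (R : realType) (A d : R) (n n' : nat) :
  0 < d -> d <= 1 / 2 ^+ 9 ->
  log2 (2 ^+ n.+1 / (2 * d)) <= (A - 1) * log2 (2 ^+ n.+1) ->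
  d * 2 ^+ n' < 2 ^+ (n + 4) -> n'%:R < A * (n.+1%:R + 1).
Proof.
move=> d0 d1; have c0 : 0 < ln 2 :> R by rewrite ln_gt0// ltr1n.
have two_pow k : 2 ^+ k \is (@Num.pos R) by rewrite posrE exprn_gt0.
have dpos : d \is Num.pos by rewrite posrE.
have pow_ln k : ln (2 ^+ k) = ln 2 * k%:R :> R by rewrite lnXn// mulr_natr.
rewrite /log2 ln_div ?posrE ?mulr_gt0 ?exprn_gt0// lnM ?posrE//.
rewrite ler_pdivrMr// mulrA mulfVK ?gt_eqF// pow_ln => log_le.
rewrite -ltr_ln ?posrE ?mulr_gt0 ?exprn_gt0// lnM// !pow_ln natrD => dn.
have : ln d <= ln (1 / 2 ^+ 9).
  by rewrite ler_ln// posrE divr_gt0// exprn_gt0.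
rewrite div1r lnV// pow_ln => lnd.
have D : exists D, ln d = - (ln 2 * D).
  by exists (- ln d / ln 2); rewrite mulrCA mulfV ?gt_eqF// mulr1 opprK.
move: D lnd log_le dn => [D ->] lnd log_le dn.
have D9 : 9 <= D by rewrite -(ler_pM2l c0); lra.
have DA : n.+1%:R - 1 + D <= (A - 1) * n.+1%:R by rewrite -(ler_pM2l c0); lra.
have nD : n'%:R < n%:R + 4 + D by rewrite -(ltr_pM2l c0); lra.
move: DA nD; rewrite -natr1; have : 0 <= n%:R :> R by [].
move: (n%:R : R) (n'%:R : R) => N N' N0 DA nD.
(* It remains to see that [3 - N <= A]. From [D >= 9] one gets [A * (N + 1) >= 2 * N + 10], which
   contradicts [N + 1 + A < 4]. *)
have : 4 <= N + 1 + A.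
  rewrite leNgt; apply/negP => NA.
  have : (N + 1 + A) * (N + 1) < 4 * (N + 1) by rewrite ltr_pM2r//; lra.
  by nra.
lra.
Qed.

(** * Construction of beta *)

Lemma unit_interval_cluster (R : realType) (b : nat -> R) :
  (forall n, 0 <= b n <= 1) ->
  exists p : R, forall (e : R) (M : nat), 0 < e ->
    exists2 n, (M <= n)%N & `|p - b n| < e.
Proof.
move=> b01; have b_itv : (b @ \oo) `[0, 1]%classic.
  by apply: (@nearW _ \oo) => n; rewrite /= in_itv /= b01.
have [p [_ pb]] := @segment_compact R 0 1 (b @ \oo) _ b_itv.
exists p => e M e0.
have Fb : (b @ \oo) (b @` [set n | (M <= n)%N]).
  by apply: filterS (nbhs_infty_ge M) => n Mn; exists n.
have [_ [[n Mn <-] pn]] := pb _ (ball (p : R) e) Fb (nbhsx_ballx (p : R) e e0).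
by exists n.
Qed.

(** A countable set is Lebesgue-null, while the interval has measure [h]. *)
Lemma interval_not_countable (R : realType) (a h : R) (C : set R) :
  0 < h -> countable C -> exists2 x, a <= x <= a + h & ~ C x.
Proof.
move=> h0 cC; apply: contrapT => none.
have sub : `[a, a + h]%classic `<=` C.
  move=> x; rewrite /= in_itv /= => xah; apply: contrapT => Cx.
  by apply: none; exists x.
have /countable_lebesgue_measure0 := sub_countable (subset_card_le sub) cC.
rewrite lebesgue_measure_itv /= lte_fin ltrDl h0 -EFinB addrAC subrr add0r.
by move=> [h00]; rewrite h00 ltxx in h0.
Qed.

(** The finite sieve needs positive radii, but [delta] may vanish from some stage on, for instance
    when [psi2] jumps at 0. In that case the sieve stops there and [beta] is chosen in the remaining
    interval off a countable set; otherwise [beta] is a cluster point of the points found by the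
    finite sieves. *)
Lemma sieve_limit (R : realType) (delta : nat -> R) (B : nat -> seq nat)
    (etas : nat -> R) (n0 : nat) :
  (forall n, 0 <= delta n) ->
  (forall n, (n0 <= n)%N -> delta n <= 1 / 2 ^+ 9) ->
  (forall n n', (n0 <= n)%N -> (n <= n')%N -> delta n' <= delta n) ->
  (forall n x, x \in B n -> (2 ^ n <= x < 2 ^ n.+1)%N) ->
  (forall n n', (n0 <= n)%N -> (n <= n')%N ->
    (forall i, (n <= i <= n')%N -> 0 < delta i) ->
    delta n * 2 ^+ n' < 2 ^+ (n + 4) ->
    \sum_(n <= k < n'.+1) delta k * (size (B k))%:R <= 10 / 2 ^+ 8) ->
  exists beta : R, forall n x, (n0 <= n)%N -> x \in B n ->
    delta n < distZ (x%:R * beta - etas x).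
Proof.
move=> delta_ge0 delta_le delta_decr BP window.
have B_gt0 n x : x \in B n -> (0 < x)%N.
  by move=> /BP /andP[nx _]; rewrite (leq_trans _ nx)// expn_gt0.
have stage N : (n0 <= N)%N -> (forall n, (n0 <= n < N)%N -> 0 < delta n) ->
    exists a h : R, [/\ 0 <= a, 0 < h, a + h <= 1 &
    forall beta, a <= beta <= a + h -> forall n x, (n0 <= n < N)%N -> x \in B n ->
    9 / 8 * delta n <= distZ (x%:R * beta - etas x)].
  move=> n0N d0; apply: dyadic_sieve => // [n nN|n n' n0n nn' n'N].
    by rewrite d0//= delta_le//; case/andP: nN.
  apply: window => // i /andP[ni in']; apply: d0.
  by rewrite (leq_trans n0n ni) (leq_ltn_trans in').
have [[N n0N dN]|pos] := pselect (exists2 N, (n0 <= N)%N & delta N = 0).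
  have ex : exists n, (n0 <= n)%N && (delta n == 0).
    by exists N; rewrite n0N dN eqxx.
  have [M /andP[n0M /eqP dM] M_min] := ex_minnP ex.
  have d_gt0 n : (n0 <= n < M)%N -> 0 < delta n.
    move=> /andP[n0n nM]; rewrite lt_neqAle delta_ge0 andbT eq_sym.
    by apply: contraTN nM => dn; rewrite -leqNgt M_min// n0n.
  have [a [h [a0 h0 _ good]]] := stage M n0M d_gt0.
  (* From [M] on the radii vanish, and only countably many beta are excluded. *)
  pose g (u : nat * int) := (u.2%:~R + etas u.1) / u.1%:R.
  have cg : countable (range g) by apply: card_le_trans (card_image_le _ _) (countableP _).
  have [beta beta_ah gbeta] := interval_not_countable R a h _ h0 cg.
  exists beta => n x n0n xB; have [nM|Mn] := ltnP n M.
    have nM' : (n0 <= n < M)%N by rewrite n0n.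
    by have := good _ beta_ah n x nM' xB; have := d_gt0 _ nM'; lra.
  have -> : delta n = 0.
    by apply/eqP; rewrite eq_le delta_ge0 andbT -dM delta_decr.
  rewrite lt_neqAle distZ_ge0 andbT; apply/eqP => dist0.
  have [k kE] := distZ_eq R (x%:R * beta - etas x).
  apply: gbeta; exists (x, k) => //.
  move: kE; rewrite -dist0 => /esym/eqP; rewrite normr_eq0 => /eqP kE.
  have x0 : x%:R != 0 :> R by rewrite pnatr_eq0 -lt0n (B_gt0 _ _ xB).
  rewrite /g /=; apply: (mulIf x0); rewrite mulfVK//; lra.
have d_gt0 n : (n0 <= n)%N -> 0 < delta n.
  move=> n0n; rewrite lt_neqAle delta_ge0 andbT eq_sym.
  by apply/eqP => dn; apply: pos; exists n.
(* The factor 9 / 8 keeps the inequality strict in the limit. *)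
have /choice[b bP] N : exists b : R, 0 <= b <= 1 /\
    forall n x, (n0 <= n < N)%N -> x \in B n ->
    9 / 8 * delta n <= distZ (x%:R * b - etas x).
  have [n0N|Nn0] := leqP n0 N.
    have [|a [h [a0 h0 ah good]]] := stage N n0N; first by move=> n /andP[/d_gt0].
    exists a; split; first by apply/andP; split; lra.
    by apply: good; apply/andP; split; lra.
  exists 0; split; first by rewrite lexx ler01.
  by move=> n x /andP[n0n nN]; have := leq_ltn_trans n0n nN; rewrite ltnNge ltnW.
have [p pP] := unit_interval_cluster R b (fun n => proj1 (bP n)).
exists p => n x n0n xB; have d0 := d_gt0 _ n0n.
have x0 : 0 < x%:R :> R by rewrite ltr0n (B_gt0 _ _ xB).
have [|N nN pb] := pP (delta n / (16 * x%:R)) n.+1; first by rewrite divr_gt0// mulr_gt0.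
have := proj2 (bP N) n x; rewrite n0n nN => /(_ isT xB) far.
have := distZ_lipschitz R (x%:R * b N - etas x) (x%:R * p - etas x).
rewrite opprB addrA subrK -mulrBr normrM normr_nat distrC.
have : x%:R * `|p - b N| < delta n / 16.
  by rewrite mulrC -ltr_pdivlMr// -mulrA -invfM.
lra.
Qed.

Theorem theorem2 (R : realType)
  (omega1 : R -> R) (Omega : R -> R -> R)
  (phi1 phi2 psi1 psi2 psi1' psi2' : R -> R)
  (A eps X0 alpha eta : R)
  (omega1_ge0 : nonneg_fun omega1)
  (omega1_incr : strictly_increasing omega1)
  (Omega_ge0 : forall s t : R, 0 <= s -> 0 <= t -> 0 <= Omega s t)
  (OmegaP : admissible_Omega omega1 Omega)
  (phi1_ge0 : nonneg_fun phi1) (phi2_ge0 : nonneg_fun phi2)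
  (psi1_ge0 : nonneg_fun psi1) (psi2_ge0 : nonneg_fun psi2)
  (phi1_incr : increasing phi1) (phi2_incr : increasing phi2)
  (phi1_0 : phi1 0 = 0) (phi2_0 : phi2 0 = 0)
  (psi1_0 : psi1 0 = 0) (psi2_0 : psi2 0 = 0)
  (* eps / phi_j (2 ^ nu) is formed for every integer nu *)
  (phi1_neq0 : forall nu : int, phi1 (2 ^ nu) != 0)
  (phi2_neq0 : forall nu : int, phi2 (2 ^ nu) != 0)
  (psi1_incr : strictly_increasing psi1)
  (psi2_incr : strictly_increasing psi2)
  (psi1'P : inverse_function psi1 psi1')
  (psi2'P : inverse_function psi2 psi2')
  (A_gt1 : 1 < A) (eps_gt0 : 0 < eps) (X0_ge0 : 0 <= X0)
  (alphaP : (1%:E <= ereal_inf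
     [set (omega1 x%:R * distZ (x%:R * alpha))%:E
       | x in [set x : nat | (0 < x)%N]])%E)
  (log_le : forall X : R, X0 <= X ->
     log2 (X / (2 * psi2' (eps / phi2 X))) <= (A - 1) * log2 X)
  (* X is on a binary logarithmic scale: it ranges over the X >= 0 for which
     [2^X, 2^(X+1)[ meets [X0, +oo[ *)
  (S2_le : (ereal_sup
     [set (S2 Omega phi1 phi2 psi1' psi2' A eps X)%:E
       | X in [set X : R | (0 <= X /\ X0 < 2 `^ (X + 1))%R]]
     <= (1 / 2 ^+ 9)%:E)%E) :
  forall etas : nat -> R, exists beta : R,
    (eps%:E <= ereal_inf
      [set (Num.max (phi1 x%:R * psi1 (distZ (x%:R * alpha - eta)))
                    (phi2 x%:R * psi2 (distZ (x%:R * beta - etas x))))%:E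
        | x in [set x : nat | (0 < x)%N /\ (X0 <= x%:R)%R]])%E.
Proof.
move=> etas.
pose delta (n : nat) := Defs.radius phi2 psi2' eps n.
pose r (n : nat) := Defs.radius phi1 psi1' eps n.
have [psi1'_ge0 psi1'_incr psi1K] := psi1'P.
have [psi2'_ge0 psi2'_incr psi2K] := psi2'P.
have two_ge0 n : 0 <= 2 ^+ n :> R by rewrite exprn_ge0.
have phi1_gt0 n : 0 < phi1 (2 ^+ n).
  by rewrite lt_neqAle eq_sym phi1_ge0// andbT; exact: phi1_neq0 (Posz n).
have phi2_gt0 n : 0 < phi2 (2 ^+ n).
  by rewrite lt_neqAle eq_sym phi2_ge0// andbT; exact: phi2_neq0 (Posz n).
have delta_ge0 n : 0 <= delta n.
  by apply: psi2'_ge0; rewrite divr_ge0 ?(ltW eps_gt0)//; exact: ltW (phi2_gt0 n).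
have r_ge0 n : 0 <= r n.
  by apply: psi1'_ge0; rewrite divr_ge0 ?(ltW eps_gt0)//; exact: ltW (phi1_gt0 n).
have delta_decr n n' : (n <= n')%N -> delta n' <= delta n.
  move=> nn'; apply: psi2'_incr.
    by rewrite divr_ge0 ?(ltW eps_gt0)//; exact: ltW (phi2_gt0 n').
  rewrite ler_pM2l//; change ((phi2 (2 ^+ n'))^-1 <= (phi2 (2 ^+ n))^-1).
  by rewrite lef_pV2 ?posrE// phi2_incr// ler_eXn2l ?ltr1n.
have alpha_bad d : (0 < d)%N -> 1 <= omega1 d%:R * distZ (d%:R * alpha).
  move=> d0; rewrite -lee_fin; apply: le_trans alphaP _.
  by apply: ereal_inf_lbound; exists d.
(* With the least such [n0], every positive integer [x >= X0] lies in some [[2 ^ n, 2 ^ (n + 1)[]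
   with [n >= n0], and each [n >= n0] is an allowed value of [X] in [S2_le]. *)
have ex_n0 : exists n, X0 < 2 ^+ n.+1.
  exists (Num.truncn X0); have /andP[_ /lt_le_trans] := truncn_itv X0_ge0; apply.
  by rewrite -[leRHS]natrX ler_nat ltnW// ltn_expl.
have [n0 n0P n0_min] := ex_minnP ex_n0.
have X0_lt n : (n0 <= n)%N -> X0 < 2 ^+ n.+1.
  by move=> n0n; apply: lt_le_trans n0P _; rewrite ler_eXn2l ?ltr1n.
pose term (n : nat) := delta n *
  Num.max (Omega (1 / (2 * r n)) (2 ^+ n.+1)) (Num.max (2 ^+ n * r n) 1).
have term_sum n k : (n0 <= n)%N -> (n <= k)%N -> k%:R < A * (n%:R + 1) ->
    \sum_(n <= i < k.+1) term i <= 1 / 2 ^+ 9.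
  move=> n0n nk kA.
  apply: le_trans (S2_ge R Omega phi1 phi2 psi1' psi2' A eps n k delta_ge0 nk kA) _.
  rewrite -lee_fin; apply: le_trans S2_le; apply: ereal_sup_ubound.
  by exists n%:R => //=; rewrite natr1 powR_mulrn//; split; rewrite ?X0_lt.
have term_le n : (n0 <= n)%N -> term n <= 1 / 2 ^+ 9.
  move=> n0n; have := term_sum n n n0n (leqnn n); rewrite big_nat1; apply.
  have : 0 <= n%:R :> R by []. nra.
have delta_term n : delta n <= term n by rewrite ler_peMr// !le_max lexx !orbT.
pose B n := [seq x <- iota (2 ^ n) (2 ^ n) | distZ (x%:R * alpha - eta) <= r n].
have B_term n : delta n * (size (B n))%:R <= 10 * term n.
  rewrite /term mulrCA ler_wpM2l//.
  exact: near_alpha_count omega1_incr Omega_ge0 OmegaP alpha_bad (r_ge0 n).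
have BE n x : x \in B n =
    (distZ (x%:R * alpha - eta) <= r n) && (2 ^ n <= x < 2 ^ n.+1)%N.
  by rewrite mem_filter mem_iota expnS mul2n -addnn.
have [beta betaP] : exists beta : R, forall n x, (n0 <= n)%N -> x \in B n ->
    delta n < distZ (x%:R * beta - etas x).
  apply: sieve_limit => //.
  - by move=> n n0n; apply: le_trans (delta_term n) (term_le n n0n).
  - by move=> n n' _; exact: delta_decr.
  - by move=> n x; rewrite BE => /andP[].
  move=> n n' n0n nn' delta_gt0 short.
  apply: (@le_trans _ _ (10 * \sum_(n <= i < n'.+1) term i)).
    by rewrite mulr_sumr ler_sum.
  have : \sum_(n <= i < n'.+1) term i <= 2 * (1 / 2 ^+ 9).
    (* The windows starting at [n] and at [n + 1] cover the range of indices. *)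
    rewrite big_ltn// [2 * _]mulr_natl mulr2n lerD ?term_le//.
    move: nn'; rewrite leq_eqVlt => /orP[/eqP <-|nn']; first by rewrite big_geq.
    have n0n1 : (n0 <= n.+1)%N := leqW n0n.
    (* The logarithmic hypothesis is used at [2 ^ (n + 1)], since [2 ^ n] may be below [X0] when
       [n = n0]. *)
    apply: term_sum => //.
    apply: (window_length R A (delta n.+1) n n') => //.
    - by apply: delta_gt0; rewrite leqnSn nn'.
    - exact: le_trans (delta_term _) (term_le _ n0n1).
    - exact: log_le (ltW (X0_lt n n0n)).
    - by apply: le_lt_trans short; rewrite ler_pM2r ?exprn_gt0// delta_decr.
  by rewrite !exprS expr0; lra.
exists beta; apply: le_ereal_inf_tmp => _ [x [x0 X0x] <-]; rewrite lee_fin.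
set n := trunc_log 2 x.
have /andP[nx xn] : (2 ^ n <= x < 2 ^ n.+1)%N by exact: trunc_log_bounds.
have n0n : (n0 <= n)%N.
  by apply: n0_min; apply: le_lt_trans X0x _; rewrite -natrX ltr_nat.
have nxR : 2 ^+ n <= x%:R :> R by rewrite -natrX ler_nat.
(* If both terms were below [eps], then, as [2 ^ n <= x], monotonicity and the inverse functions
   would put [x] in [B n] and [x * beta] within [delta n] of [etas x] modulo 1, against [betaP]. *)
rewrite leNgt gt_max; apply/negP => /andP[bad1 bad2].
have radius_bound (phi psi psi' : R -> R) (y : R) :
    increasing phi -> nonneg_fun psi -> increasing psi' ->
    (forall t, 0 <= t -> psi' (psi t) = t) -> 0 < phi (2 ^+ n) -> 0 <= y ->
    phi x%:R * psi y < eps -> y <= Defs.radius phi psi' eps n.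
  move=> phi_incr psi_ge0 psi'_incr psiK phi_gt0 y0 small.
  rewrite -[leLHS]psiK//; apply: psi'_incr; first exact: psi_ge0.
  rewrite ler_pdivlMr// mulrC; apply: le_trans (ltW small).
  by rewrite ler_wpM2r ?psi_ge0// phi_incr.
have near1 := radius_bound _ _ _ _ phi1_incr psi1_ge0 psi1'_incr psi1K (phi1_gt0 n)
  (distZ_ge0 _ _) bad1.
have near2 := radius_bound _ _ _ _ phi2_incr psi2_ge0 psi2'_incr psi2K (phi2_gt0 n)
  (distZ_ge0 _ _) bad2.
have := betaP n x n0n; rewrite BE near1 nx xn => /(_ isT).
by rewrite ltNge near2.
Qed.
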